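(* Let $m\ge 0$ be an integer and let $\Lambda^2=\mathbb{Z}\times\mathbb{Z}$ with forward jump operator $\sigma(t)=t+1$. Let $P(m,b,x)$ be the polynomial defined in the context. Then for every $t\in\mathbb{Z}$, $$\frac{\Delta x^{2m+1}}{\Delta x}(t)=\frac{\partial P(m,b,x)}{\Delta x}(m,\sigma(t),t)+\frac{\partial P(m,b,x)}{\Delta b}(m,t,t),$$ where $\frac{\Delta x^{2m+1}}{\Delta x}(t)=(t+1)^{2m+1}-t^{2m+1}$ is the finite difference of $x^{2m+1}$ at $t$.
   Context: The polynomial $P$. Define real coefficients $\mathbf{A}_{m,r}$, $0\le r\le m$, recursively (downward in $r$) by $\mathbf{A}_{m,m}=(2m+1)\binom{2m}{m}$ and, for $0\le r<m$, $\mathbf{A}_{m,r}=(2r+1)\binom{2r}{r}\sum_{d=2r+1}^{m}\mathbf{A}_{m,d}\binom{d}{2r+1}\frac{(-1)^{d-1}}{d-r}B_{2d-2r}$, where $B_k$ are the Bernoulli numbers (an empty sum is $0$). For nonnegative integers $b$, $P(m,b,x)=\sum_{k=0}^{b-1}\sum_{r=0}^{m}\mathbf{A}_{m,r}\,k^r(x-k)^r$ with the convention $0^0=1$. This is a polynomial in $x$ and $b$, and for arbitrary real $b,x$ the symbol $P(m,b,x)$ denotes the value of the unique polynomial in $b$ and $x$ that agrees with this sum for all nonnegative integers $b$ and all real $x$. Partial derivatives on the time scale $\mathbb{Z}$ (arguments listed in the order $(m,b,x)$): $\frac{\partial P(m,b,x)}{\Delta x}(m,c,t)=\frac{P(m,c,\sigma(t))-P(m,c,t)}{\sigma(t)-t}$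 and $\frac{\partial P(m,b,x)}{\Delta b}(m,t,c)=\frac{P(m,\sigma(t),c)-P(m,t,c)}{\sigma(t)-t}$, with $\sigma(t)-t=1$. *)

(* Defs.v *)
From HB Require Import structures.
From mathcomp Require Import all_boot all_order all_algebra.
From mathcomp Require Import classical_sets reals.
Set Implicit Arguments.
Unset Strict Implicit.
Unset Printing Implicit Defensive.
Import Order.TTheory GRing.Theory Num.Theory.
Local Open Scope ring_scope.

Section Bernoulli.
Variable R : realType.

(* [:: B_0; ...; B_(n-1)], from \sum_(k <= n) 'C(n+1, k) B_k = [n = 0]. *)
Fixpoint bernoulli_seq (n : nat) : seq R :=
  if n is n'.+1 then
    let s := bernoulli_seq n' in
    rcons s (((n' == 0%N)%:R - \sum_(k < n') 'C(n'.+1, k)%:R * s`_k) / n'.+1%:R)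
  else [::].

Definition bernoulli (n : nat) : R := (bernoulli_seq n.+1)`_n.

Lemma size_bernoulli_seq n : size (bernoulli_seq n) = n.
Proof. by elim: n => //= n IHn; rewrite size_rcons IHn. Qed.

Lemma nth_bernoulli_seq n k : (k < n)%N -> (bernoulli_seq n)`_k = bernoulli k.
Proof.
elim: n => // n IHn; rewrite ltnS leq_eqVlt => /predU1P[->//|ltkn] /=.
by rewrite nth_rcons size_bernoulli_seq ltkn IHn.
Qed.

Lemma bernoulliE n :
  \sum_(k < n.+1) 'C(n.+1, k)%:R * bernoulli k = (n == 0%N)%:R.
Proof.
rewrite big_ord_recr /= binSn {2}/bernoulli /=.
rewrite nth_rcons size_bernoulli_seq ltnn eqxx mulrC divfK ?pnatr_eq0 //.
under eq_bigr => k _ do rewrite -(nth_bernoulli_seq (ltn_ord k)).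
by rewrite addrC subrK.
Qed.

End Bernoulli.

Section CoefA.
Variables (R : realType) (m : nat).

(* Right-hand side of the recursion for A_(m,r), r < m, given the A_(m,d). *)
Definition coefA_step (A : nat -> R) (r : nat) : R :=
  ((2 * r + 1) * 'C(2 * r, r))%:R *
  \sum_(2 * r + 1 <= d < m.+1)
     A d * 'C(d, 2 * r + 1)%:R * ((-1) ^+ (d - 1) / (d - r)%:R)
     * bernoulli R (2 * d - 2 * r).

(* coefA_tab j d is A_(m,d) for m - j <= d <= m. *)
Fixpoint coefA_tab (j : nat) : nat -> R :=
  if j is j'.+1 then
    fun d => if d == (m - j)%N then coefA_step (coefA_tab j') d
             else coefA_tab j' d
  else fun d => if d == m then ((2 * m + 1) * 'C(2 * m, m))%:R else 0.

Definition coefA (r : nat) : R := coefA_tab (m - r) r.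

Lemma coefA_mm : coefA m = ((2 * m + 1) * 'C(2 * m, m))%:R.
Proof. by rewrite /coefA subnn /= eqxx. Qed.

Lemma coefA_tabE j d : (j <= m)%N -> (m - j <= d <= m)%N ->
  coefA_tab j d = coefA d.
Proof.
elim: j => [|j IHj] lejm /andP[led ledm].
  have -> : d = m by apply/eqP; rewrite eqn_leq ledm -[X in (X <= _)%N]subn0.
  by rewrite /coefA subnn.
have [eqd|ned] := eqVneq d (m - j.+1)%N.
  by rewrite eqd /coefA subKn.
rewrite /= (negbTE ned) IHj ?(ltnW lejm) // ledm andbT.
by rewrite -subSS subSn // ltn_neqAle eq_sym ned led.
Qed.

Lemma coefA_rec r : (r < m)%N -> coefA r = coefA_step coefA r.
Proof.
move=> ltrm; rewrite {1}/coefA; case Ej: (m - r)%N => [|j].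
  by move: ltrm; rewrite -subn_gt0 Ej.
have Er : r = (m - j.+1)%N by rewrite -Ej subKn // ltnW.
rewrite /= -Er eqxx /coefA_step; congr (_ * _).
apply: eq_big_nat => d /andP[led ltd]; congr (_ * _ * _ * _).
have ltjm : (j < m)%N by rewrite -Ej leq_subr.
apply: coefA_tabE; first exact: ltnW.
move: ltd; rewrite ltnS => ->; rewrite andbT.
have -> : (m - j)%N = r.+1 by rewrite Er -subSS subSn.
by apply: leq_trans led; rewrite addn1 ltnS mul2n -addnn leq_addr.
Qed.

End CoefA.

Section PolyP.
Variables (R : realType) (m : nat).

Definition P_sum (b : nat) (x : R) : R :=
  \sum_(0 <= k < b) \sum_(0 <= r < m.+1)
     coefA R m r * k%:R ^+ r * (x - k%:R) ^+ r.

(* Bivariate polynomials are R[x][b]: the outer indeterminate stands for b. *)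
Definition interpolates_P (p : {poly {poly R}}) : Prop :=
  forall (b : nat) (x : R), p.[(b%:R)%:P].[x] = P_sum b x.

Definition P_poly : {poly {poly R}} :=
  xget 0 [set p : {poly {poly R}} | interpolates_P p]%classic.

Definition P (b x : R) : R := P_poly.[b%:P].[x].

End PolyP.

Section PolyPTheory.
Variables (R : realType) (m : nat).

Lemma poly_natr_roots_eq0 (D : idomainType) (p : {poly D}) :
  injective (fun n : nat => n%:R : D) -> (forall n : nat, p.[n%:R] = 0) -> p = 0.
Proof.
move=> injn p0; apply/eqP/negPn/negP => pn0.
have := @max_poly_roots _ p [seq n%:R | n <- iota 0 (size p)] pn0.
rewrite size_map size_iota ltnn => H; apply: notF; apply: H.
  by apply/allP => _ /mapP[n _ ->]; apply/rootP.
by rewrite map_inj_uniq ?iota_uniq.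
Qed.

Lemma natr_inj_realType : injective (fun n : nat => n%:R : R).
Proof. by move=> a b /eqP; rewrite eqr_nat => /eqP. Qed.

Lemma natr_inj_poly : injective (fun n : nat => n%:R : {poly R}).
Proof. by move=> a b; rewrite -!polyC_natr => /polyC_inj/natr_inj_realType. Qed.

Lemma interpolates_P_unique (p q : {poly {poly R}}) :
  interpolates_P m p -> interpolates_P m q -> p = q.
Proof.
move=> hp hq; apply/eqP; rewrite -subr_eq0; apply/eqP.
apply: poly_natr_roots_eq0 natr_inj_poly _ => b.
apply: poly_natr_roots_eq0 natr_inj_realType _ => x.
by rewrite -polyC_natr !hornerE hp hq subrr.
Qed.

Lemma power_sum_poly (j : nat) :
  exists s : {poly R}, forall b : nat, s.[b%:R] = \sum_(0 <= k < b) k%:R ^+ j.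
Proof.
have [S hS] : exists S : nat -> {poly R}, forall i, (i < j.+1)%N ->
    forall b : nat, (S i).[b%:R] = \sum_(0 <= k < b) k%:R ^+ i; last first.
  by exists (S j); apply: hS.
elim: j.+1 => [|n [S hS]]; first by exists (fun=> 0).
pose s := n.+1%:R^-1 *: ('X^(n.+1) - \sum_(i < n) 'C(n.+1, i)%:R *: S i).
exists (fun i => if i == n then s else S i) => i; rewrite ltnS leq_eqVlt.
case: eqP => [-> _ b|_ /= /hS//].
have n1 : n.+1%:R != 0 :> R by rewrite pnatr_eq0.
apply: (mulfI n1); rewrite /s hornerZ mulVKf // hornerD hornerN hornerXn.
rewrite horner_sum.
under eq_bigr => k _ do rewrite hornerZ hS //.
elim: b => [|b IHb].
  rewrite big_nil expr0n sub0r mulr0 big1 ?oppr0 // => k _.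
  by rewrite big_nil mulr0.
rewrite big_nat_recr //= mulrDr -IHb.
under eq_bigr => k _ do rewrite big_nat_recr //= mulrDr.
rewrite big_split /= opprD addrA [LHS]addrAC [RHS]addrAC; congr (_ - _).
rewrite -natr1 [b%:R + 1]addrC exprDn !big_ord_recr /= subnn binn mulr1n expr0 mul1r.
under [X in X + _ + _ - _]eq_bigr => k _ do rewrite expr1n mul1r.
rewrite subSnn expr1n mul1r binSn.
under [X in _ - X]eq_bigr => k _ do rewrite mulr_natl.
by rewrite [LHS]addrC -addrA addKr addrC mulr_natl.
Qed.

Lemma interpolates_P_ex : exists p : {poly {poly R}}, interpolates_P m p.
Proof.
have sumE (g : {poly {poly R}}) : exists p : {poly {poly R}},
    forall b : nat, p.[b%:R] = \sum_(0 <= k < b) g.[k%:R].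
  elim/poly_ind: g => [|g c _].
    by exists 0 => b; rewrite big1 ?horner0 // => k _; rewrite horner0.
  move: (g * 'X + c%:P) => {c}g.
  have [S hS] := boolp.choice power_sum_poly.
  exists (\sum_(i < size g) g`_i *: map_poly polyC (S i)) => b.
  rewrite horner_sum.
  under eq_bigr => i _.
    rewrite hornerZ -(polyC_natr _ b) horner_map /= hS rmorph_sum mulr_sumr /=.
    over.
  rewrite exchange_big /=; apply: eq_bigr => k _.
  rewrite horner_coef; apply: eq_bigr => i _.
  by rewrite rmorphXn /= polyC_natr.
have [p hp] := sumE (\sum_(0 <= r < m.+1)
  (coefA R m r)%:P%:P * 'X ^+ r * ('X%:P - 'X) ^+ r).
exists p => b x; rewrite polyC_natr hp /P_sum horner_sum.
apply: eq_bigr => k _; rewrite !horner_sum; apply: eq_bigr => r _.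
by rewrite !hornerE -polyC_natr !hornerE.
Qed.

Lemma P_polyP : interpolates_P m (P_poly R m).
Proof. by apply: xgetPex; exact: interpolates_P_ex. Qed.

Lemma P_nat (b : nat) (x : R) : P m b%:R x = P_sum m b x.
Proof. exact: P_polyP. Qed.

End PolyPTheory.

Section DeltaDerivative.
Variable R : realType.

Definition sigma (t : int) : int := t + 1.

Definition delta_deriv (f : int -> R) (t : int) : R :=
  (f (sigma t) - f t) / ((sigma t)%:~R - t%:~R).

(* Arguments in the order (m, b, x), for F viewed on the time scale Z x Z. *)
Definition delta_dx (F : nat -> R -> R -> R) (m : nat) (b x : int) : R :=
  delta_deriv (fun u : int => F m b%:~R u%:~R) x.

Definition delta_db (F : nat -> R -> R -> R) (m : nat) (b x : int) : R :=
  delta_deriv (fun u : int => F m u%:~R x%:~R) b.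

Lemma delta_derivE (f : int -> R) (t : int) : delta_deriv f t = f (t + 1) - f t.
Proof. by rewrite /delta_deriv /sigma -rmorphB /= addrAC subrr add0r divr1. Qed.

End DeltaDerivative.

(* Main.v *)
Require Import Defs.
From mathcomp Require Import all_boot all_order all_algebra.
From mathcomp Require Import reals.
From mathcomp Require Import ring zify.
Import Order.TTheory GRing.Theory Num.Theory.
Local Open Scope ring_scope.

(** The right-hand side telescopes to [P m (t+1) (t+1) - P m t t], so the
    theorem is the diagonal identity [P m x x = x ^+ (2m+1)] ([P_diag]). Both
    sides are polynomials in [x], so it is enough to prove it at a natural
    number [n], where it reads
<<
      \sum_(r <= m) A_(m,r) S_r(n) = n^(2m+1),
      S_r(n) = \sum_(0 <= k < n) k^r (n-k)^r.
>>
    The point is that [S_r(n)] is an odd polynomial in [n] with explicit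
    coefficients. Apply the Euler-Maclaurin formula, which is exact on
    polynomials, to an antiderivative of [f = X^r (n-X)^r]
    ([sum_symmetric_powers]).
    - The integral term is [n^(2r+1) / c_r] with [c_r = (2r+1) 'C(2r, r)],
      because [c_r f] is the derivative of the upper tail of the binomial
      expansion of [(X + (n-X))^(2r+1)] ([deriv_beta_tail]); this tail is
      [n^(2r+1)] at [n] and [0] at [0].
    - The other terms compare the Taylor coefficients of [f] at [0] and at [n].
      Since [f] is invariant under [X |-> n - X], they agree up to the sign
      [(-1)^l] ([nderivn_symmetric]), so only odd [l] survive, each counted
      twice, and the coefficients of [f] at [0] are binomial coefficients.

    Therefore [S_r(n)] is [n^(2r+1) / c_r] minus the sum over [s < r] of
    [symmetric_coef r s * n^(2s+1)]. The [symmetric_coef d r] are exactly the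
    factors of [A_(m,d)] in the recursion for [A_(m,r)]: the recursion and the
    value of [A_(m,m)] say that the coefficient of [n^(2r+1)] in the sum of the
    [A_(m,d) S_d(n)] vanishes for [r < m] and is [1] for [r = m]
    ([sum_coefA]). *)

(** * Euler-Maclaurin summation of polynomials *)

Lemma polyMn_inj (R : numDomainType) n (p q : {poly R}) :
  (0 < n)%N -> p *+ n = q *+ n -> p = q.
Proof.
move=> n0 e; apply/polyP => i; have /polyP/(_ i) := e; rewrite !coefMn => /eqP.
by rewrite eqr_pMn2r // => /eqP.
Qed.

Lemma nderivn_nderivn (R : numDomainType) (p : {poly R}) i j :
  (p^`N(i))^`N(j) = p^`N(j + i) *+ 'C(j + i, i).
Proof.
apply: (@polyMn_inj _ (i`! * j`!)); first by rewrite muln_gt0 !fact_gt0.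
have e : ('C(j + i, i) * (i`! * j`!) = (j + i)`!)%N.
  by rewrite -(bin_fact (leq_addl j i)) addnK.
rewrite -mulrnA e -nderivn_def mulrnA.
by rewrite -nderivnMn -!nderivn_def /derivn -iterD.
Qed.

Lemma nderivn_deriv (R : numDomainType) (p : {poly R}) i :
  p^`()^`N(i) = p^`N(i.+1) *+ i.+1.
Proof. by rewrite -[in LHS]nderivn1 nderivn_nderivn addn1 bin1. Qed.

(** The Taylor formula with step [1]. The sum may start at [k = 0], whatever [i]
    is, because ['C(k, i)] vanishes for [k < i]; this rectangular form is what
    allows the exchange of sums in [euler_maclaurin]. *)
Lemma nderivn_taylor1 (R : numDomainType) (p : {poly R}) (N i : nat) (x : R) :
  (size p <= N)%N ->
  p^`N(i).[x + 1] = \sum_(k < N) p^`N(k).[x] *+ 'C(k, i).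
Proof.
move=> sN; have [ltNi|leiN] := ltnP N i.
  rewrite nderivn_poly0 ?(leq_trans sN (ltnW _)) // horner0 big1 // => k _.
  by rewrite bin_small // (ltn_trans (ltn_ord k)).
rewrite (@nderiv_taylor_wide _ (N - i)) //; first last.
- by apply: leq_trans (size_poly _ _) _; rewrite leq_sub2r.
- exact: commr1.
rewrite -(big_mkord xpredT (fun k => p^`N(k).[x] *+ 'C(k, i))).
rewrite [RHS](big_cat_nat _ leiN) //=.
have -> : \sum_(0 <= k < i) p^`N(k).[x] *+ 'C(k, i) = 0.
  by rewrite big_nat big1 // => k /andP[_ ki]; rewrite bin_small.
have /= := @big_addn _ 0 +%R 0%N N i xpredT (fun k => p^`N(k).[x] *+ 'C(k, i)).
rewrite !add0r add0n => ->; rewrite big_mkord; apply: eq_bigr => l _.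
by rewrite expr1n mulr1 nderivn_nderivn hornerMn.
Qed.

(** The recursion for the Bernoulli numbers, as [B_k(1) - B_k = [k = 1]] for
    Bernoulli polynomials. *)
Lemma sum_bin_bernoulli (R : realType) (N k : nat) : (k < N)%N ->
  \sum_(i < N) bernoulli R i *+ 'C(k, i) = bernoulli R k + (k == 1%N)%:R.
Proof.
move=> ltkN; rewrite -(big_mkord xpredT (fun i => bernoulli R i *+ 'C(k, i))).
rewrite (big_cat_nat _ ltkN) //=.
have -> : \sum_(k.+1 <= i < N) bernoulli R i *+ 'C(k, i) = 0.
  by rewrite big_nat big1 // => i /andP[ki _]; rewrite bin_small.
rewrite addr0 big_nat_recr //= binn addrC; congr (_ + _).
case: k ltkN => [|k] _; first by rewrite big_geq.
rewrite eqSS -bernoulliE big_mkord; apply: eq_bigr => i _.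
by rewrite mulr_natl.
Qed.

(** The operator [T = \sum_i B_i D^i / i!] is [D / (exp D - 1)] and
    [exp D] is the shift by [1], so [T p (x+1) - T p x = p' x]; the sum then
    telescopes. *)
Lemma euler_maclaurin (R : realType) (p : {poly R}) (N n : nat) :
  (size p <= N)%N ->
  \sum_(0 <= k < n) p^`().[k%:R] =
  \sum_(i < N) bernoulli R i * (p^`N(i).[n%:R] - p^`N(i).[0]).
Proof.
move=> sN; pose T x := \sum_(i < N) bernoulli R i * p^`N(i).[x].
have TS x : p^`().[x] = T (x + 1) - T x.
  rewrite /T; under eq_bigr do rewrite (nderivn_taylor1 _ _ _ _ _ sN) mulr_sumr.
  rewrite exchange_big /= -sumrB.
  under eq_bigr => k _.
    under eq_bigr do rewrite mulrnAr -mulrnAl.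
    rewrite -mulr_suml (sum_bin_bernoulli _ _ _ (ltn_ord k)) -mulrBl addrC addKr.
    over.
  have [N1|N1] := ltnP 1 N.
    rewrite (bigD1 (Ordinal N1)) //= mul1r nderivn1 big1 ?addr0 // => k.
    by rewrite -val_eqE /= => /negbTE ->; rewrite mul0r.
  rewrite -nderivn1 nderivn_poly0 ?(leq_trans sN) // horner0 big1 // => k _.
  rewrite (_ : _ == _ = false) ?mul0r //; apply/eqP => e.
  by have := ltn_ord k; rewrite e ltnNge N1.
under eq_bigr => k _ do rewrite TS natr1.
rewrite (telescope_sumr (fun k => T k%:R)) // /T -sumrB.
by apply: eq_bigr => i _; rewrite mulrBr.
Qed.

(** * The summand [X^r (c-X)^r] *)

(** An antiderivative of the Beta integrand (the incomplete Beta function): the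
    derivatives of consecutive terms of the binomial expansion of
    [(X + (c-X))^(n+1)] cancel, so that a tail of the expansion keeps only its
    boundary term. *)
Lemma deriv_beta_tail (R : comNzRingType) (c : R) (n r : nat) : (r <= n)%N ->
  (\sum_(r <= i < n.+1) 'X^(i.+1) * (c%:P - 'X) ^+ (n - i) *+ 'C(n.+1, i.+1))^`()
  = ('X^r * (c%:P - 'X) ^+ (n - r)) *+ (n.+1 * 'C(n, r)).
Proof.
move=> lern.
pose h i : {poly R} := 'X^i * (c%:P - 'X) ^+ (n - i) *+ (n.+1 * 'C(n, i)).
rewrite raddf_sum (@telescope_sumr_eq _ _ _ (fun i => - h i)) ?(leq_trans lern) //.
  by rewrite opprK {1}/h bin_small // muln0 mulr0n oppr0 add0r.
move=> i /andP[_ lein].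
have eb : ((n - i) * 'C(n.+1, i.+1) = n.+1 * 'C(n, i.+1))%N.
  by rewrite (mul_bin_down n.+1 i.+1) subSS.
rewrite /h (mul_bin_diag n.+1 i) -eb /= derivMn derivM derivXn.
rewrite deriv_exp derivB derivC derivX sub0r mulN1r mulNrn mulrN mulrnBl opprK addrC /= -subnS.
by rewrite !mulrnAl !mulrnAr -!mulrnA.
Qed.

Lemma derivn_comp_reflect (R : comNzRingType) (p : {poly R}) (c : R) (l : nat) :
  (p \Po (c%:P - 'X))^`(l) = (-1) ^+ l *: (p^`(l) \Po (c%:P - 'X)).
Proof.
elim: l => [|l IHl]; first by rewrite scale1r.
rewrite derivnS IHl derivZ deriv_comp derivB derivC derivX sub0r mulrN1 scalerN.
by rewrite exprS mulN1r scaleNr -derivnS.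
Qed.

Lemma nderivn_symmetric (R : numDomainType) (p : {poly R}) (c : R) (l : nat) :
  p \Po (c%:P - 'X) = p -> p^`N(l).[c] = (-1) ^+ l * p`_l.
Proof.
move=> sym.
have p0 : p^`N(l).[0] = p`_l by rewrite horner_coef0 coef_nderivn addn0 binn.
have e : p^`N(l) = (-1) ^+ l *: (p^`N(l) \Po (c%:P - 'X)).
  apply: (@polyMn_inj _ l`!); first exact: fact_gt0.
  rewrite scalerMnr -[X in _ = _ *: X](raddfMn (comp_poly _)).
  by rewrite -nderivn_def -{1}sym derivn_comp_reflect.
by rewrite e hornerZ horner_comp !hornerE subrr p0.
Qed.

Lemma coef_subX_exp (R : comNzRingType) (c : R) (r k : nat) :
  ((c%:P - 'X) ^+ r)`_k = (-1) ^+ k * c ^+ (r - k) *+ 'C(r, k).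
Proof.
rewrite exprBn coef_sum.
under eq_bigr => i _.
  rewrite -polyC_exp -(rmorph_sign (@polyC R)) -rmorphM coefMn.
  rewrite coefCM coefXn.
  over.
have [ltkr|ltrk] := ltnP k r.+1.
  rewrite (bigD1 (Ordinal ltkr)) //= eqxx mulr1 big1 ?addr0 // => i.
  by rewrite -val_eqE eq_sym => /negbTE /= ->; rewrite mulr0 mul0rn.
rewrite bin_small // mulr0n big1 // => i _.
by rewrite gtn_eqF ?mulr0 ?mul0rn // (leq_trans _ ltrk).
Qed.

(** The odd indices below [2d] are listed downwards because [2(d-s)-1] is the
    order of the Taylor coefficient that carries [n^(2s+1)]. *)
Lemma sum_odd_indices (V : nmodType) (F : nat -> V) (d : nat) :
  (forall s, F (2 * s)%N = 0) ->
  \sum_(l < (2 * d).+1) F l = \sum_(s < d) F (2 * (d - s)).-1%N.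
Proof.
move=> F0; rewrite [RHS](reindex_inj rev_ord_inj) /=.
transitivity (\sum_(s < d) F (2 * s).+1).
  rewrite big_ord_recr /= F0 addr0.
  elim: d => [|d IHd]; first by rewrite muln0 !big_ord0.
  by rewrite mulnS !big_ord_recr /= -IHd F0 addr0.
apply: eq_bigr => s _; congr (F _); have := ltn_ord s; lia.
Qed.

(** The coefficient of [n^(2s+1)], for [s < d], in the sum of the
    [- k^d (n-k)^d] over [0 <= k < n], in the shape it has in the recursion for
    [coefA]. *)
Definition symmetric_coef (R : realType) (d s : nat) : R :=
  'C(d, 2 * s + 1)%:R * ((-1) ^+ (d - 1) / (d - s)%:R)
  * bernoulli R (2 * d - 2 * s).

Lemma symmetric_coef_small (R : realType) (d s : nat) :
  (d < 2 * s + 1)%N -> symmetric_coef R d s = 0.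
Proof. by move=> lt; rewrite /symmetric_coef bin_small // !mul0r. Qed.

(** The closed form of the sum of the [k^r (n-k)^r]: only odd powers of [n]
    occur, by the symmetry of the summand under [k |-> n - k]. *)
Lemma sum_symmetric_powers (R : realType) (r n : nat) :
  ((2 * r + 1) * 'C(2 * r, r))%:R *
    (\sum_(0 <= k < n) k%:R ^+ r * (n%:R - k%:R) ^+ r
     + \sum_(s < r) symmetric_coef R r s * n%:R ^+ (2 * s + 1))
  = n%:R ^+ (2 * r + 1).
Proof.
set c : R := ((2 * r + 1) * _)%:R; set N : R := n%:R.
pose f : {poly R} := 'X^r * (N%:P - 'X) ^+ r.
pose G : {poly R} := \sum_(r <= i < (2 * r).+1)
  'X^(i.+1) * (N%:P - 'X) ^+ (2 * r - i) *+ 'C((2 * r).+1, i.+1).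
have lerr : (r <= 2 * r)%N by rewrite leq_pmull.
have G' : G^`() = c *: f.
  rewrite /G (deriv_beta_tail _ _ _ _ lerr) /c /f scaler_nat addn1.
  by congr (_ * _ ^+ _ *+ _); lia.
have fsym : f \Po (N%:P - 'X) = f.
  rewrite /f rmorphM /= !rmorphXn /= rmorphB /= comp_polyX comp_polyC.
  by rewrite opprB addrCA subrr addr0 mulrC.
have sG : (size G <= (2 * r).+2)%N.
  apply/leq_sizeP => j ltj; rewrite /G coef_sum big_nat big1 // => i /andP[_ lti].
  rewrite coefMn coefXnM coef_subX_exp ltnNge (leq_trans _ (ltnW ltj)) //=.
  by rewrite bin_small ?mulr0n ?mul0rn //; lia.
have coef_f l : f`_l = if (l < r)%N then 0
    else (-1) ^+ (l - r) * N ^+ (r - (l - r)) *+ 'C(r, l - r).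
  by rewrite /f coefXnM coef_subX_exp.
have GN : G.[N] = N ^+ (2 * r + 1).
  rewrite /G horner_sum big_nat_recr //= subnn expr0 mulr1 binn.
  rewrite hornerXn addn1 big_nat big1 ?add0r // => i /andP[_ lti].
  rewrite hornerMn hornerM horner_exp !hornerE subrr expr0n subn_eq0 leqNgt lti.
  by rewrite mulr0 mul0rn.
have G0 : G.[0] = 0.
  rewrite /G horner_sum big1 // => i _.
  by rewrite hornerMn hornerM hornerXn exprS !mul0r mul0rn.
(* The boundary terms: two equal contributions for odd l, none for even l. *)
have GS l : G^`N(l.+1).[N] - G^`N(l.+1).[0]
    = c * (((-1) ^+ l - 1) * f`_l) / l.+1%:R.
  have := nderivn_deriv _ G l; rewrite G' nderivnZ => e.
  have eN x : c * f^`N(l).[x] = G^`N(l.+1).[x] * l.+1%:R.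
    by rewrite -hornerZ e hornerMn mulr_natr.
  apply: (canRL (mulfK _)); first by rewrite pnatr_eq0.
  rewrite mulrBl -!eN nderivn_symmetric // horner_coef0 coef_nderivn addn0 binn.
  ring.
have := euler_maclaurin _ G _ n sG.
rewrite big_ord_recl nderivn0 GN G0 subr0.
have -> : bernoulli R 0 = 1 by have := bernoulliE R 0; rewrite big_ord1 bin0 mul1r.
rewrite mul1r mulrDr => e.
rewrite -[RHS](addrK (\sum_(l < (2 * r).+1) bernoulli R l.+1 *
   (c * (((-1) ^+ l - 1) * f`_l) / l.+1%:R))).
congr (_ + _).
  under [X in _ + X]eq_bigr do rewrite -GS.
  rewrite -e mulr_sumr; apply: eq_bigr => k _.
  by rewrite G' hornerZ /f !hornerE.
rewrite (sum_odd_indices _ (fun l => bernoulli R l.+1 *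
   (c * (((-1) ^+ l - 1) * f`_l) / l.+1%:R))); last first.
  by move=> s; rewrite exprM sqrrN !expr1n subrr !(mul0r, mulr0).
rewrite mulr_sumr -sumrN; apply: eq_bigr => s _.
have ltsr := ltn_ord s.
have r1 : (r - s)%:R != 0 :> R by rewrite pnatr_eq0 subn_eq0 -ltnNge.
have -> : ((2 * (r - s)).-1.+1 = 2 * (r - s))%N by lia.
have -> : (-1) ^+ (2 * (r - s)).-1 = -1 :> R.
  have -> : ((2 * (r - s)).-1 = 1 + 2 * (r - s).-1)%N by lia.
  by rewrite exprD exprM sqrrN !expr1n mulr1.
rewrite /symmetric_coef; have -> : (2 * r - 2 * s = 2 * (r - s))%N by lia.
rewrite coef_f; case: ltnP => le.
  rewrite bin_small; last by lia.
  by rewrite !(mul0r, mulr0) oppr0.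
have -> : ((2 * (r - s)).-1 - r = r - (2 * s + 1))%N by lia.
have les : (2 * s + 1 <= r)%N by lia.
rewrite bin_sub // subKn //.
have -> : (-1) ^+ (r - 1) = (-1) ^+ (r - (2 * s + 1)) :> R.
  have -> : (r - 1 = r - (2 * s + 1) + 2 * s)%N by lia.
  by rewrite exprD exprM sqrrN !expr1n mulr1.
rewrite natrM -mulr_natr; field.
by rewrite r1.
Qed.

(** * The diagonal of [P] *)

Lemma central_coef_neq0 (R : numDomainType) (r : nat) :
  ((2 * r + 1) * 'C(2 * r, r))%:R != 0 :> R.
Proof. by rewrite pnatr_eq0 muln_eq0 addn1 -lt0n bin_gt0 leq_pmull. Qed.

(** The recursion that defines [coefA], read as the value of the coefficient of
    [n^(2s+1)] in the sum of the [A_(m,d) k^d (n-k)^d]. The sum may run over all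
    [d <= m], since [symmetric_coef R d s] vanishes for [d < 2s+1]. *)
Lemma sum_coefA (R : realType) (m s : nat) : (s < m.+1)%N ->
  coefA R m s / ((2 * s + 1) * 'C(2 * s, s))%:R
    - \sum_(d < m.+1) coefA R m d * symmetric_coef R d s = (s == m)%:R.
Proof.
have c0 := central_coef_neq0 R s.
rewrite ltnS leq_eqVlt => /predU1P[eqsm | ltsm].
  rewrite eqsm in c0 *; rewrite eqxx coefA_mm divff // big1 ?subr0 // => d _.
  by rewrite symmetric_coef_small ?mulr0 //; have := ltn_ord d; lia.
rewrite ltn_eqF // coefA_rec // /coefA_step mulrC mulKf //.
apply/eqP; rewrite subr_eq0; apply/eqP.
rewrite -(big_mkord xpredT (fun d => coefA R m d * symmetric_coef R d s)).
have tail0 : \sum_(0 <= d < m.+1 | (d < 2 * s + 1)%N)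
   coefA R m d * symmetric_coef R d s = 0.
  by apply: big1 => d lt; rewrite symmetric_coef_small ?mulr0.
rewrite [RHS](bigID (fun d => d < 2 * s + 1)%N) /= tail0 add0r.
rewrite (big_nat_widenl _ 0) //=.
by apply: eq_big => d; [rewrite -leqNgt | rewrite /symmetric_coef !mulrA].
Qed.

Lemma P_sum_diag (R : realType) (m n : nat) :
  P_sum m n (n%:R : R) = n%:R ^+ (2 * m + 1).
Proof.
rewrite /P_sum exchange_big_nat big_mkord /=.
pose c d : R := ((2 * d + 1) * 'C(2 * d, d))%:R.
transitivity (\sum_(d < m.+1) (coefA R m d / c d * n%:R ^+ (2 * d + 1)
   - \sum_(s < m.+1) coefA R m d * symmetric_coef R d s * n%:R ^+ (2 * s + 1))).
  apply: eq_bigr => d _.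
  under eq_bigr do rewrite -mulrA.
  rewrite -mulr_sumr -sum_symmetric_powers -/(c d) mulrA divfK ?central_coef_neq0 //.
  rewrite mulrDr -[LHS]addr0 -addrA; congr (_ + _); apply/esym/eqP.
  rewrite subr_eq0 mulr_sumr; apply/eqP.
  rewrite (big_ord_widen m.+1 (fun s => coefA R m d * (symmetric_coef R d s
    * n%:R ^+ (2 * s + 1)))) ?(ltnW (ltn_ord d)) //.
  rewrite big_mkcond; apply: eq_bigr => s _; case: ltnP => les.
    by rewrite mulrA.
  by rewrite symmetric_coef_small ?mulr0 ?mul0r //; lia.
rewrite sumrB [X in _ - X]exchange_big /= -sumrB.
under eq_bigr => s _ do rewrite -mulr_suml -mulrBl (sum_coefA _ _ _ (ltn_ord s)).
rewrite big_ord_recr /= eqxx mul1r big1 ?add0r // => s _.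
by rewrite ltn_eqF ?mul0r.
Qed.

(** Restriction of a bivariate polynomial to the diagonal is again a
    polynomial; this is how [P_diag] passes from naturals to all reals. *)
Lemma horner_diag (A : comNzRingType) (p : {poly {poly A}}) (x : A) :
  p.['X].[x] = p.[x%:P].[x].
Proof.
elim/poly_ind: p => [|p c IHp]; first by rewrite !horner0.
by rewrite !hornerE IHp.
Qed.

Lemma P_diag (R : realType) (m : nat) (x : R) : P m x x = x ^+ (2 * m + 1).
Proof.
rewrite /P -horner_diag -hornerXn; congr (_.[x]).
apply/eqP; rewrite -subr_eq0; apply/eqP.
apply: poly_natr_roots_eq0 (@natr_inj_realType R) _ => n.
by rewrite !hornerE horner_diag P_polyP P_sum_diag subrr.
Qed.

Theorem corollary4p1 (R : realType) (m : nat) (t : int) :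
  delta_deriv (fun x : int => (x%:~R : R) ^+ (2 * m + 1)) t
  = delta_dx (@P R) m (sigma t) t + delta_db (@P R) m t t.
Proof.
by rewrite /delta_dx /delta_db !delta_derivE /sigma addrA subrK !P_diag.
Qed.
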